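(* Let $X_1,\ldots,X_n,Y_1,\ldots,Y_n$ be independent, identically distributed real random variables with mean $\mu$ and (finite) variance $\sigma^2$. Let $\delta\in(0,1)$ be such that $n>(16/3)\log(8/\delta)$. Let $\widehat{\mu}_{2n}$ be the trimmed-mean estimator with confidence level $\delta$ defined in the context (where $\varepsilon n$, with $\varepsilon=\frac{16\log(8/\delta)}{3n}$, is assumed for simplicity to be an integer). Then, with probability at least $1-\delta$, \[ \left|\widehat{\mu}_{2n}-\mu\right| \le 9\sigma\sqrt{\frac{\log(8/\delta)}{n}}. \]
   Context: For real numbers $\alpha\le\beta$ define the truncation function $\phi_{\alpha,\beta}:\mathbb{R}\to\mathbb{R}$ by $\phi_{\alpha,\beta}(x)=\beta$ if $x>\beta$, $\phi_{\alpha,\beta}(x)=x$ if $x\in[\alpha,\beta]$, and $\phi_{\alpha,\beta}(x)=\alpha$ if $x<\alpha$. For $x_1,\ldots,x_m\in\mathbb{R}$, let $x_1^*\le x_2^*\le\cdots\le x_m^*$ denote the non-decreasing rearrangement. Trimmed-mean estimator: given the confidence level $\delta\ge 8e^{-3n/16}$, set \[ \varepsilon=\frac{16\log(8/\delta)}{3n}. \] Let $\alpha=Y^*_{\varepsilon n}$ and $\beta=Y^*_{(1-\varepsilon)n}$ (assuming, for simplicity, that $\varepsilon n$ is an integer), where $Y_1^*\le\cdots\le Y_n^*$ is the non-decreasing rearrangement of $Y_1,\ldots,Y_n$, and define \[ \widehat{\mu}_{2n}=\frac{1}{n}\sum_{i=1}^n\phi_{\alpha,\beta}(X_i). \] $\log$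 denotes the natural logarithm.
   Formalization: The formal theorem also assumes that almost surely α = Y*_{εn} ≤ β = Y*_{(1-ε)n}, since φ_{α,β} is undefined otherwise; this is automatic when ε ≤ 1/2 but can fail for 1/2 < ε < 1, which the English allows. *)

(* Defs.v *)
From HB Require Import structures.
From mathcomp Require Import all_boot all_order all_algebra.
From mathcomp Require Import all_classical all_reals all_analysis.
Import Order.TTheory GRing.Theory Num.Theory.
Import numFieldNormedType.Exports.

Set Implicit Arguments.
Unset Strict Implicit.
Unset Printing Implicit Defensive.

Local Open Scope classical_set_scope.
Local Open Scope ring_scope.

Section probability.
Context (d : measure_display) (T : measurableType d) (R : realType)
  (P : probability T R).

Definition mutually_independent (I : finType) (Z : I -> {RV P >-> R}) : Prop :=
  forall (J : {set I}) (B : I -> set R), (forall i, measurable (B i)) ->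
    P (\bigcap_(i in [set` J]) (Z i @^-1` B i)) =
    (\prod_(i in J) P (Z i @^-1` B i))%E.

Definition identically_distributed (I : Type) (Z : I -> {RV P >-> R}) : Prop :=
  forall (i j : I) (B : set R), measurable B ->
    distribution P (Z i) B = distribution P (Z j) B.

Definition iid (I : finType) (Z : I -> {RV P >-> R}) : Prop :=
  mutually_independent Z /\ identically_distributed Z.

Definition pooled (n : nat) (X Y : 'I_n -> {RV P >-> R})
    (i : 'I_n + 'I_n) : {RV P >-> R} :=
  match i with inl j => X j | inr j => Y j end.

End probability.

Section trimmed_mean.
Context (R : realType).

(* Meaningful only when [a <= b]. *)
Definition truncation (a b x : R) : R :=
  if b < x then b else if a <= x then x else a.

(* Order statistics are numbered from 1, hence the predecessor;
   meaningful for [1 <= k <= n]. *)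
Definition order_stat (n : nat) (x : 'I_n -> R) (k : nat) : R :=
  nth 0 (sort <=%R [seq x i | i <- enum 'I_n]) k.-1.

Definition trim_level (n : nat) (delta : R) : R :=
  16 * ln (8 / delta) / (3 * n%:R).

(* [Num.truncn] rounds nothing when [trim_level n delta * n%:R] is an integer,
   the only case of interest. *)
Definition lower_threshold (n : nat) (delta : R) (y : 'I_n -> R) : R :=
  order_stat y (Num.truncn (trim_level n delta * n%:R)).

Definition upper_threshold (n : nat) (delta : R) (y : 'I_n -> R) : R :=
  order_stat y (Num.truncn ((1 - trim_level n delta) * n%:R)).

Definition trimmed_mean (n : nat) (delta : R) (x y : 'I_n -> R) : R :=
  n%:R^-1 * \sum_(i < n)
    truncation (lower_threshold delta y) (upper_threshold delta y) (x i).

End trimmed_mean.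

(* Main.v *)
(* Write L = ln (8 / delta), k = eps n = 16 L / 3, so that delta / 8 is
   exp (- 3 k / 16).  It suffices to bound the upper deviation, up to an event
   of probability 3 exp (- 3 k / 16), under assumptions on the thresholds that
   are invariant under (X, Y, alpha, beta) |-> (- X, - Y, - beta, - alpha).

   Let eta be the claimed error.  If P (Y > mu + eta) <= 15 eps / 32, which by
   Chebyshev's inequality holds whenever eps >= 3 / 8 (and trivially when
   sigma = 0), a Chernoff bound shows that beta <= mu + eta, and this bounds
   the estimator.  Otherwise let b = mu + 2 sigma / sqrt eps and let a be a
   quantile of order 2 eps.  Chernoff bounds give beta <= b and alpha <= a, so
   that the estimator is at most the mean of the variables min (max X_i a) b,
   which are bounded above and have mean at most mu + E (a - X)+.  This bias is
   at most sigma sqrt (2 eps / (1 - 2 eps)) <= 2.83 sigma sqrt eps, and the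
   exponential moment of order 3 sqrt eps / (8 sigma) controls the
   fluctuations. *)

Require Import Defs.
From HB Require Import structures.
From mathcomp Require Import all_boot all_order all_algebra.
From mathcomp Require Import finmap.
From mathcomp Require Import all_classical all_reals all_analysis.
From mathcomp Require Import measurable_realfun lra ring.
Import Order.TTheory GRing.Theory Num.Theory.
Import numFieldNormedType.Exports.

Set Implicit Arguments.
Unset Strict Implicit.
Unset Printing Implicit Defensive.

Local Open Scope classical_set_scope.
Local Open Scope ring_scope.

(** * Independence *)

Section weights.
Context (d : measure_display) (T : measurableType d) (R : realType)
  (P : {measure set T -> \bar R}).
Import HBNNSimple.

(** Monotone convergence along simple approximations of [f]. The right-hand side depends on [v] only
    through its integrals over preimages under [U]. *)
Let integral_comp_weight (U : {mfun T >-> R}) (v : T -> R) (f : R -> \bar R)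
    (mf : measurable_fun [set: R] f) :
  measurable_fun setT v -> (forall x, 0 <= v x) -> (forall y, 0 <= f y)%E ->
  (\int[P]_x (f (U x) * (v x)%:E) =
   limn (fun n => \sum_(y \in range (nnsfun_approx measurableT mf n))
     y%:E * \int[P]_x ((\1_(nnsfun_approx measurableT mf n @^-1` [set y]) (U x)
                        * v x)%:E)))%E.
Proof.
move=> mv v0 f0; pose h := nnsfun_approx measurableT mf.
have hU x : f (U x) = limn (fun n => (h n (U x))%:E).
  by apply/esym/cvg_lim => //; exact: cvg_nnsfun_approx.
transitivity (limn (fun n => \int[P]_x ((h n (U x))%:E * (v x)%:E))%E).
  rewrite -monotone_convergence //.
  - apply: eq_integral => x _; apply/esym/cvg_lim => //.
    by apply: cvgeZr => //; exact: cvg_nnsfun_approx.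
  - move=> n; apply: emeasurable_funM; apply/measurable_EFinP => //.
    by apply: measurableT_comp => //; exact/measurable_funP.
  - by move=> n x _; rewrite mule_ge0 ?lee_fin.
  - move=> x _ a b ab; rewrite lee_wpmul2r ?lee_fin//.
    exact/lefP/nd_nnsfun_approx.
congr (limn _); apply/funext => n.
have m1 (y : R) : measurable_fun setT
    (fun x => (\1_(h n @^-1` [set y]) (U x) * v x)%:E).
  apply/measurable_EFinP; apply: measurable_funM => //.
  by apply: measurableT_comp => //; exact: measurable_indic.
have E x : ((h n (U x))%:E * (v x)%:E = \sum_(y <- fset_set (range (h n)))
    (y%:E * (\1_(h n @^-1` [set y]) (U x) * v x)%:E))%E.
  rewrite fimfunE -EFinM fsbig_finite//= mulr_suml -sumEFin.
  by apply: eq_bigr => y _; rewrite -EFinM mulrA.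
under eq_integral do rewrite E.
have yge0 y : range (h n) y -> 0 <= y by move=> [x _ <-].
rewrite fsbig_finite//=.
(* [Num.max 0 y] is [y] on the range, but makes every term nonnegative. *)
rewrite (eq_integral (fun x => \sum_(y <- fset_set (range (h n)))
  ((Num.max 0 y)%:E * (\1_(h n @^-1` [set y]) (U x) * v x)%:E))%E); last first.
  move=> x _; rewrite [LHS]big_seq [RHS]big_seq; apply: eq_bigr => y.
  by rewrite in_fset_set// => /set_mem/yge0 y0; rewrite max_r.
rewrite ge0_integral_sum//.
- rewrite [LHS]big_seq [RHS]big_seq.
  apply: eq_bigr => y; rewrite in_fset_set// => /set_mem/yge0 y0.
  rewrite max_r// ge0_integralZl//.
  by move=> x _; rewrite lee_fin mulr_ge0.
- by move=> y; exact: emeasurable_funM.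
- by move=> y x _; rewrite mule_ge0// lee_fin ?mulr_ge0// le_max lexx.
Qed.

(** Two weights that agree on indicators of [U] agree on all nonnegative functions of [U]. Below,
    [v] is a product of factors independent of [U] and [w] is its mean. *)
Lemma ge0_integral_comp_weight (U : {mfun T >-> R}) (v w : T -> R)
    (f : R -> \bar R) :
  measurable_fun setT v -> (forall x, 0 <= v x) ->
  measurable_fun setT w -> (forall x, 0 <= w x) ->
  measurable_fun [set: R] f -> (forall y, 0 <= f y)%E ->
  (forall B, measurable B ->
    (\int[P]_x (\1_B (U x) * v x)%:E = \int[P]_x (\1_B (U x) * w x)%:E)%E) ->
  (\int[P]_x (f (U x) * (v x)%:E) = \int[P]_x (f (U x) * (w x)%:E))%E.
Proof.
move=> mv v0 mw w0 mf f0 vw.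
rewrite (integral_comp_weight _ mf mv)// (integral_comp_weight _ mf mw)//.
congr (limn _); apply/funext => n; apply: eq_fsbigr => y _; rewrite vw//.
Qed.
End weights.

Section independence.
Context (d : measure_display) (T : measurableType d) (R : realType)
  (P : probability T R) (I : finType) (Z : I -> {RV P >-> R}).
Hypothesis indep : mutually_independent Z.

Let prod_indic (B : I -> set R) : (forall i, measurable (B i)) ->
  (\int[P]_x (\prod_i \1_(B i) (Z i x))%:E =
   \prod_i \int[P]_x (\1_(B i) (Z i x))%:E)%E.
Proof.
move=> mB.
have mZB i : measurable (Z i @^-1` B i).
  exact: measurable_funPTI.
have -> : (fun x => (\prod_i \1_(B i) (Z i x) : R)%:E)
    = EFin \o \1_(\bigcap_(i in [set` [set: I]%SET]) (Z i @^-1` B i)).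
  apply/funext => x /=; congr EFin.
  rewrite indicE; have [xB|] := boolP (x \in _).
    rewrite big1// => i _; rewrite indicE mem_set//.
    by move/set_mem : xB; apply; rewrite /= finset.in_setT.
  rewrite notin_setE => xB.
  have [i iB] : exists i, ~ B i (Z i x).
    by apply/existsNP => h; apply: xB => i _; exact: h.
  by rewrite (bigD1 i)//= indicE memNset// mul0r.
have mcap : measurable
    (\bigcap_(i in [set` [set: I]%SET]) (Z i @^-1` B i)).
  by apply: fin_bigcap_measurable => // ; exact: finite_finset.
rewrite integral_indic// setIT; etransitivity; first exact: indep.
rewrite (eq_bigl xpredT); last by move=> i; rewrite finset.in_setT.
apply: eq_bigr => i _.
rewrite (_ : (fun x => _) = EFin \o \1_(Z i @^-1` B i))//.
by rewrite integral_indic// setIT.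
Qed.

Lemma ge0_integral_prod_independent (f : I -> R -> R) :
  (forall i, measurable_fun [set: R] (f i)) -> (forall i y, 0 <= f i y) ->
  (forall i, \int[P]_x (f i (Z i x))%:E < +oo)%E ->
  (\int[P]_x (\prod_i f i (Z i x))%:E =
   \prod_i \int[P]_x (f i (Z i x))%:E)%E.
Proof.
(* The factors are freed from being indicators one index at a time. *)
suff H (s : seq I) (g : I -> R -> R) :
  (forall i, measurable_fun [set: R] (g i)) -> (forall i y, 0 <= g i y) ->
  (forall i, \int[P]_x (g i (Z i x))%:E < +oo)%E ->
  (forall i, i \notin s ->
    exists2 B : set R, measurable B & g i = \1_B) ->
  (\int[P]_x (\prod_i g i (Z i x))%:E =
   \prod_i \int[P]_x (g i (Z i x))%:E)%E.
  by move=> mf f0 fy; apply: (H (enum I)) => // i; rewrite mem_enum.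
elim: s g => [|j s IH] g mg g0 gy gB.
  have /choice[B Bg] : forall i, exists B : set R, measurable B /\ g i = \1_B.
    by move=> i; have [//|B mB ->] := gB i; exists B.
  rewrite (_ : g = fun i => \1_(B i)); last first.
    by apply/funext => i; case: (Bg i).
  by apply: prod_indic => i; case: (Bg i).
pose W x := \prod_(i | i != j) g i (Z i x).
pose c := (\prod_(i | i != j) \int[P]_x (g i (Z i x))%:E)%E.
have gfin i : (\int[P]_x (g i (Z i x))%:E)%E \is a fin_num.
  by rewrite ge0_fin_numE// integral_ge0// => x _; rewrite lee_fin.
have c_fin : c \is a fin_num by apply: prode_fin_num => i _.
have c_ge0 : (0 <= c)%E.
  by apply: prode_ge0 => i _; rewrite integral_ge0// => x _; rewrite lee_fin.
have mgZ i : measurable_fun setT (fun x => g i (Z i x)).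
  exact: measurableT_comp.
have mW : measurable_fun setT W.
  rewrite /W; under eq_fun do rewrite -big_filter.
  exact: measurable_prod.
have W0 x : 0 <= W x by exact: prodr_ge0.
have c0 : 0 <= fine c by exact: fine_ge0.
(* Against functions of [Z j], the weight [W] may be replaced by its mean [c]; this has to be
   checked on indicators only. *)
have key := @ge0_integral_comp_weight d T R P (Z j) W (fun=> fine c)
  (EFin \o g j) mW W0 _ (fun=> c0).
transitivity (\int[P]_x ((EFin \o g j) (Z j x) * (W x)%:E))%E.
  by apply: eq_integral => x _; rewrite (bigD1 j)//= EFinM.
rewrite (bigD1 j)//= -/c -(fineK c_fin) key//.
- by rewrite ge0_integralZr//; first exact/measurable_EFinP;
    move=> x _; rewrite lee_fin.
- exact/measurable_EFinP.
- by move=> y; rewrite lee_fin.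
move=> B mB.
(* With an indicator at index [j], the family falls under the induction hypothesis for [s]. *)
pose h i := if i == j then \1_B else g i.
have mZB : measurable (Z j @^-1` B).
  exact: measurable_funPTI.
have intB : (\int[P]_x (\1_B (Z j x))%:E = P (Z j @^-1` B))%E.
  rewrite (_ : (fun x => _) = EFin \o \1_(Z j @^-1` B))//.
  by rewrite integral_indic// setIT.
have hj : h j = \1_B by rewrite /h eqxx.
have hi i : i != j -> h i = g i by rewrite /h => /negbTE ->.
transitivity (\int[P]_x (\prod_i h i (Z i x))%:E)%E.
  apply: eq_integral => x _; rewrite (bigD1 j)//= hj; congr (_ * _)%:E.
  by apply: eq_bigr => i ij; rewrite hi.
rewrite IH.
- rewrite (bigD1 j)//= hj (eq_bigr (fun i => \int[P]_x (g i (Z i x))%:E)%E);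
    last by move=> i ij; rewrite hi.
  rewrite -/c -(fineK c_fin) -ge0_integralZr//.
    by apply/measurable_EFinP; apply: measurableT_comp.
- by move=> i; have [->|ij] := eqVneq i j; [rewrite hj|rewrite hi].
- by move=> i y; have [->|ij] := eqVneq i j; [rewrite hj|rewrite hi].
- move=> i; have [->|ij] := eqVneq i j; last by rewrite hi.
  by rewrite hj intB (le_lt_trans (probability_le1 P mZB))// ltry.
- move=> i si; have [->|ij] := eqVneq i j; first by rewrite hj; exists B.
  by rewrite hi//; apply: gB; rewrite inE negb_or ij.
Qed.
End independence.

(** * Chernoff bounds *)

Section chernoff.
Context (d : measure_display) (T : measurableType d) (R : realType)
  (P : probability T R) (I : finType) (Z : I -> {RV P >-> R}).
Hypothesis indep : mutually_independent Z.

Lemma measurable_sum_comp (J : pred I) (g : R -> R) :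
  measurable_fun [set: R] g ->
  measurable_fun setT (fun x => \sum_(i | J i) g (Z i x)).
Proof.
move=> mg; under eq_fun do rewrite -big_filter.
by apply: measurable_sum => i; exact: measurableT_comp.
Qed.

Lemma measurable_le_set (f : T -> R) (c : R) : measurable_fun setT f ->
  measurable [set x | c <= f x].
Proof.
move=> mf; rewrite (_ : [set x | _] = f @^-1` `[c, +oo[).
  by rewrite -[X in measurable X]setTI; exact: mf.
by apply/seteqP; split => x /=; rewrite in_itv/= andbT.
Qed.

(** Markov's inequality for the exponential of the sum, whose mean factorizes by independence. *)
Lemma chernoff_independent_sum (J : pred I) (g : R -> R) (c t : R) :
  measurable_fun [set: R] g ->
  (forall i, J i -> \int[P]_x (expR (g (Z i x)))%:E <= (expR c)%:E)%E ->
  (P [set x | (t <= \sum_(i | J i) g (Z i x))%R] <=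
   (expR (#|J|%:R * c - t))%:E)%E.
Proof.
move=> mg gc; set A := [set x | _].
have mA : measurable A by apply: measurable_le_set; exact: measurable_sum_comp.
(* Indices outside [J] contribute a factor 1, so that the product runs over all of [I]. *)
pose f i y := if J i then expR (g y) else 1.
have mf i : measurable_fun [set: R] (f i).
  by rewrite /f; case: (J i) => //; exact: measurableT_comp.
have f0 i y : 0 <= f i y by rewrite /f; case: ifP.
have int1 : (\int[P]_x (1%:E : \bar R) = 1%E)%E.
  by rewrite integral_cst//= mul1e probability_setT.
have fc i : (\int[P]_x (f i (Z i x))%:E <=
    (if J i then expR c else 1)%:E)%E.
  by rewrite /f; case: ifP => [/gc//|_]; rewrite int1.
have prodE x : \prod_i f i (Z i x) = expR (\sum_(i | J i) g (Z i x)).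
  by rewrite expR_sum -big_mkcond.
have le1 : ((expR t)%:E * P A <= (expR (#|J|%:R * c))%:E)%E.
  have -> : (P A = \int[P]_x (\1_A x)%:E)%E by rewrite integral_indic// setIT.
  rewrite -ge0_integralZl_EFin ?expR_ge0//; last first.
    exact/measurable_EFinP/measurable_indic.
  apply: (@le_trans _ _ (\int[P]_x (\prod_i f i (Z i x))%:E)%E).
    apply: ge0_le_integral => //.
    - apply/measurable_EFinP; apply: measurable_funM => //.
    - apply/measurable_EFinP; under eq_fun do rewrite prodE.
      by apply: measurableT_comp => //; exact: measurable_sum_comp.
    - move=> x _; rewrite prodE -EFinM lee_fin indicE.
      have [/set_mem xA|_] := boolP (x \in A).
        by rewrite mulr1 ler_expR.
      by rewrite mulr0 expR_ge0.
  rewrite ge0_integral_prod_independent//; last first.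
    by move=> i; rewrite (le_lt_trans (fc i))// ltry.
  have ffin i : (\int[P]_x (f i (Z i x))%:E)%E \is a fin_num.
    rewrite ge0_fin_numE ?(le_lt_trans (fc i)) ?ltry// integral_ge0// => x _.
    by rewrite lee_fin.
  under eq_bigr do rewrite -(fineK (ffin _)).
  rewrite prodEFin lee_fin expRM_natl -prodr_const [leRHS]big_mkcond/=.
  apply: ler_prod => i _.
  rewrite -!lee_fin fineK// integral_ge0 => [|x _]; last by rewrite lee_fin.
  exact: fc.
rewrite -(lee_pmul2l (x := (expR t)%:E)) ?lte_fin ?expR_gt0//.
by rewrite -EFinM -expRD addrCA subrr addr0.
Qed.

(** Chernoff bound at parameter [ln 2]: there the exponential of an indicator is 1 plus the
    indicator, of mean at most [1 + p <= expR p]. *)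
Lemma count_upper_tail (J : pred I) (B : set R) (p k : R) : measurable B ->
  (forall i, J i -> P (Z i @^-1` B) <= p%:E)%E ->
  (P [set x | (k <= \sum_(i | J i) \1_B (Z i x))%R] <=
   (expR (#|J|%:R * p - k * ln 2))%:E)%E.
Proof.
move=> mB pB; set A := [set x | _].
have ln2 : 0 < ln 2 :> R by rewrite ln_gt0// ltr1n.
have -> : A = [set x | k * ln 2 <= \sum_(i | J i) (\1_B (Z i x) * ln 2)].
  by apply/seteqP; split => x /=; rewrite -mulr_suml ler_pM2r.
apply: (chernoff_independent_sum (g := fun y => \1_B y * ln 2)).
  by apply: measurable_funM => //; exact: measurable_indic.
move=> i Ji; have mZB : measurable (Z i @^-1` B).
  exact: measurable_funPTI.
have E x : (expR (\1_B (Z i x) * ln 2))%:E = (1 + (\1_(Z i @^-1` B) x)%:E)%E.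
  rewrite !indicE -EFinD; congr EFin.
  have [/set_mem xB|/negP xB] := boolP (Z i x \in B).
    by rewrite mul1r lnK ?posrE// mem_set.
  by rewrite mul0r expR0 memNset ?addr0// => /mem_set.
under eq_integral do rewrite E.
rewrite ge0_integralD//; last exact/measurable_EFinP/measurable_indic.
rewrite integral_cst//= mul1e probability_setT integral_indic// setIT.
apply: (@le_trans _ _ (1 + p%:E)%E); first by rewrite leeD2l// pB.
by rewrite lee_fin expR_ge1Dx.
Qed.

(** Chernoff bound at parameter [- ln 2]: the exponential is 1 minus half the indicator, of mean at
    most [1 - p / 2 <= expR (- (p / 2))]. *)
Lemma count_lower_tail (J : pred I) (B : set R) (p k : R) : measurable B ->
  (forall i, J i -> p%:E <= P (Z i @^-1` B))%E ->
  (P [set x | (\sum_(i | J i) \1_B (Z i x) <= k)%R] <=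
   (expR (k * ln 2 - #|J|%:R * (p / 2)))%:E)%E.
Proof.
move=> mB pB; set A := [set x | _].
have ln2 : 0 < ln 2 :> R by rewrite ln_gt0// ltr1n.
have -> : A = [set x | - (k * ln 2) <= \sum_(i | J i) (- \1_B (Z i x) * ln 2)].
  by apply/seteqP; split => x /=; rewrite -mulr_suml sumrN mulNr lerN2 ler_pM2r.
have -> : k * ln 2 - #|J|%:R * (p / 2) = #|J|%:R * - (p / 2) - - (k * ln 2).
  by rewrite opprK mulrN addrC.
apply: (@chernoff_independent_sum J (fun y => - \1_B y * ln 2)).
  apply: measurable_funM => //; apply: measurable_funN.
  exact: measurable_indic.
move=> i Ji; have mZB : measurable (Z i @^-1` B).
  exact: measurable_funPTI.
have E x : (expR (- \1_B (Z i x) * ln 2))%:E =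
    (1 - 2^-1%:E * (\1_(Z i @^-1` B) x)%:E)%E.
  rewrite !indicE -EFinM -EFinB; congr EFin.
  have [/set_mem xB|/negP xB] := boolP (Z i x \in B).
    by rewrite mulN1r expRN lnK ?posrE// mem_set//=; lra.
  by rewrite oppr0 mul0r expR0 memNset ?mulr0 ?subr0// => /mem_set.
under eq_integral do rewrite E.
have int1 : P.-integrable setT (fun x => (\1_(Z i @^-1` B) x)%:E : \bar R).
  exact: integrable_indic.
rewrite integralB//; first last.
- exact: integrableZl.
- exact: finite_measure_integrable_cst.
rewrite integralZl// integral_cst//= mul1e probability_setT.
rewrite integral_indic// setIT.
apply: (@le_trans _ _ (1 - 2^-1%:E * p%:E)%E).
  by rewrite leeB// lee_pmul2l ?pB.
by rewrite lee_fin -mulrC -mulNr expR_ge1Dx.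
Qed.
End chernoff.

(** * Moments *)

Section real_inequalities.
Context (R : realType).

(** Since [1 - u / 4 <= expR (- u / 4)], the fourth power gives [(1 - u / 4) ^+ 4 <= expR (- u)],
    and a polynomial inequality remains. *)
Lemma expR_le_quadratic (u : R) : u <= 3 / 4 -> expR u <= 1 + u + u ^+ 2.
Proof.
move=> u34; have v0 : 0 <= 1 - u / 4 by lra.
have H : (1 - u / 4) ^+ 4 <= (expR u)^-1.
  rewrite -expRN (_ : - u = 4%:R * (- (u / 4))); last by lra.
  by rewrite expRM_natl lerXn2r ?nnegrE ?expR_ge0// expR_ge1Dx.
have q0 : 0 <= 1 + u + u ^+ 2 by have := sqr_ge0 (u + 2^-1); nra.
have poly : 1 <= (1 + u + u ^+ 2) * (1 - u / 4) ^+ 4.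
  pose v := u / 4; have -> : u = 4 * v by rewrite /v; lra.
  have {}u34 : v <= 3 / 16 by rewrite /v; lra.
  have E : (1 + 4 * v + (4 * v) ^+ 2) * (1 - 4 * v / 4) ^+ 4 =
      1 + v ^+ 2 * (6 - 44 * v + 81 * v ^+ 2 - 60 * v ^+ 3 + 16 * v ^+ 4).
    by field.
  rewrite E lerDl mulr_ge0 ?sqr_ge0//.
  have v4 : 0 <= v ^+ 4.
    by rewrite (_ : v ^+ 4 = (v ^+ 2) ^+ 2) ?sqr_ge0//; ring.
  have [vn|vp] := leP v 0.
    have : v ^+ 3 <= 0 by rewrite exprS mulr_le0_ge0 ?sqr_ge0.
    have := sqr_ge0 v; lra.
  suff : 0 <= 6 - 44 * v + 81 * v ^+ 2 - 60 * v ^+ 3 by lra.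
  (* The cubic exceeds this product by [3 / 8 - 7 / 8 * v - v ^+ 2 / 4], which is positive for
     [0 < v <= 3 / 16]. *)
  have : 0 <= (3 / 16 - v) * (30 - 70 * v + 60 * v ^+ 2).
    by apply: mulr_ge0; [lra|have := sqr_ge0 v; lra].
  by have := sqr_ge0 v; nra.
rewrite -[expR u]mul1r -ler_pdivlMr ?expR_gt0// (le_trans poly)//.
by rewrite ler_wpM2l.
Qed.
Lemma clamp_lipschitz (a b x y : R) :
  `|Num.min (Num.max x a) b - Num.min (Num.max y a) b| <= `|x - y|.
Proof.
wlog xy : x y / x <= y.
  by move=> H; have [/H//|/ltW/H] := leP x y; rewrite distrC (distrC y).
rewrite (ler0_norm (_ : x - y <= 0)) ?subr_le0// ler_norml; apply/andP.
by case: (leP x a) => ?; case: (leP y a) => ?; case: (leP a b) => ?;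
  case: (leP x b) => ?; case: (leP y b) => ?; split; lra.
Qed.
End real_inequalities.

Section moments.
Context (d : measure_display) (T : measurableType d) (R : realType)
  (P : probability T R) (X : {RV P >-> R}) (mu sigma : R).
Hypothesis X_mean : ('E_P[X] = mu%:E)%E.
Hypothesis X_variance : ('V_P[X] = (sigma ^+ 2)%R%:E)%E.

Let integral_sq : (\int[P]_w ((X w - mu) ^+ 2)%:E = (sigma ^+ 2)%:E)%E.
Proof.
rewrite -X_variance /variance unlock X_mean unlock.
by apply: eq_integral.
Qed.

(** A class closed under linear combinations whose members are integrable along [X], because [X] has
    a second moment; [mean] below is linear and monotone on it. *)
Let quadratic (f : R -> R) := measurable_fun [set: R] f /\
  exists C, forall y, `|f y| <= C * (1 + (y - mu) ^+ 2).

Let quadratic_integrable (f : R -> R) : quadratic f ->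
  P.-integrable setT (fun w => (f (X w))%:E).
Proof.
move=> [mf [C fC]].
apply: (@le_integrable _ _ _ _ _ measurableT _
  (fun w => C%:E * (1 + ((X w - mu) ^+ 2)%:E))%E).
- by apply/measurable_EFinP; exact: measurableT_comp.
- move=> w _; rewrite -EFinD -EFinM !abse_EFin lee_fin.
  by rewrite (le_trans (fC _))// ler_norm.
- apply: integrableZl => //; apply: integrableD => //.
    exact: finite_measure_integrable_cst.
  apply/integrableP; split.
    apply/measurable_EFinP; apply: measurable_funX.
    by apply: measurable_funB.
  under eq_integral do rewrite gee0_abs ?lee_fin ?sqr_ge0//.
  by rewrite integral_sq ltry.
Qed.

Let quadratic_lin (f : R -> R) (a b : R) : measurable_fun [set: R] f ->
  (forall y, `|f y| <= `|a| + `|b| * `|y - mu|) -> quadratic f.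
Proof.
move=> mf fab; split => //; exists (`|a| + `|b|) => y.
rewrite (le_trans (fab y))// -[(y - mu) ^+ 2]real_normK ?num_real//.
rewrite mulrDl lerD//.
  by rewrite ler_peMr// lerDl sqr_ge0.
by rewrite ler_wpM2l//; have := sqr_ge0 (`|y - mu| - 1); nra.
Qed.

Let quadraticZ (c : R) (f : R -> R) :
  quadratic f -> quadratic (fun y => c * f y).
Proof.
move=> [mf [C fC]]; split; first exact: measurable_funM.
by exists (`|c| * C) => y; rewrite normrM -mulrA ler_wpM2l.
Qed.

Let quadraticD (f g : R -> R) :
  quadratic f -> quadratic g -> quadratic (fun y => f y + g y).
Proof.
move=> [mf [C fC]] [mg [D gD]]; split; first exact: measurable_funD.
by exists (C + D) => y; rewrite mulrDl (le_trans (ler_normD _ _))// lerD.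
Qed.

Let quadratic_cst (c : R) : quadratic (fun=> c).
Proof.
by apply: (@quadratic_lin _ c 0) => // y; rewrite normr0 mul0r addr0.
Qed.

Let quadratic_id : quadratic id.
Proof.
apply: (@quadratic_lin _ mu 1) => // y.
by rewrite normr1 mul1r -{1}(subrK mu y) addrC ler_normD.
Qed.

Let quadratic_sq : quadratic (fun y => (y - mu) ^+ 2).
Proof.
split; first by apply: measurable_funX; exact: measurable_funB.
by exists 1 => y; rewrite ger0_norm ?sqr_ge0// mul1r lerDr.
Qed.

Let quadratic_lt (a : R) : quadratic \1_[set y | y < a].
Proof.
apply: (@quadratic_lin _ 1 0).
  apply: measurable_indic; rewrite (_ : [set y | _] = `]-oo, a[%classic)//.
by move=> y; rewrite normr0 mul0r addr0 normr1 indicE ger0_norm// lern1 leq_b1.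
Qed.

Let quadratic_pos (a b : R) : quadratic (fun y => Num.max 0 (a + b * y)).
Proof.
apply: (@quadratic_lin _ (`|a| + `|b| * `|mu|) b).
  by apply: measurable_maxr => //; apply: measurable_funD.
move=> y; rewrite (ger0_norm (addr_ge0 _ (mulr_ge0 _ _)))//.
rewrite -addrA -mulrDr.
have E : `|a + b * y| <= `|a| + `|b| * (`|mu| + `|y - mu|).
  rewrite (le_trans (ler_normD _ _))// lerD2l normrM ler_wpM2l//.
  by rewrite -{1}(subrK mu y) addrC ler_normD.
rewrite (le_trans _ E)//; case: (leP 0 (a + b * y)) => // _.
by rewrite normr0.
Qed.

Let mean f := \int[P]_w f (X w).

Let meanD f g : quadratic f -> quadratic g ->
  mean (fun y => f y + g y) = mean f + mean g.
Proof.
by move=> /quadratic_integrable ? /quadratic_integrable ?; exact: RintegralD.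
Qed.

Let meanZ c f : quadratic f -> mean (fun y => c * f y) = c * mean f.
Proof. by move=> /quadratic_integrable ?; exact: RintegralZl. Qed.

Let mean_cst c : mean (fun=> c) = c.
Proof. by rewrite /mean Rintegral_cst//= probability_setT/= mulr1. Qed.

Let mean_id : mean id = mu.
Proof. by rewrite /mean /Rintegral -[RHS]/(fine mu%:E) -X_mean unlock. Qed.

Let mean_sq : mean (fun y => (y - mu) ^+ 2) = sigma ^+ 2.
Proof. by rewrite /mean /Rintegral integral_sq. Qed.

Let le_mean f g : quadratic f -> quadratic g -> (forall y, f y <= g y) ->
  mean f <= mean g.
Proof.
move=> /quadratic_integrable ? /quadratic_integrable ? fg.
exact: le_Rintegral.
Qed.

Lemma mean_opp : ('E_P[(fun w => - X w)%R] = (- mu)%:E)%E.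
Proof.
rewrite unlock (eq_integral (fun w => (-1)%:E * (X w)%:E)%E).
  rewrite integralZl//; last exact: quadratic_integrable quadratic_id.
  by have := X_mean; rewrite unlock => ->; rewrite -EFinM mulN1r.
by move=> w _; rewrite -EFinM mulN1r.
Qed.

Lemma variance_opp : ('V_P[(fun w => - X w)%R] = (sigma ^+ 2)%R%:E)%E.
Proof.
rewrite /variance unlock mean_opp unlock -integral_sq.
apply: eq_integral => w _; congr (_%:E).
by rewrite -[LHS]/((- X w + - - mu) * (- X w + - - mu)); ring.
Qed.

(* With [U = (a - X)+], [V = (X - a)+], [h = E U], [g = E V], the square
   [(X - mu)^2 = (V - U - (g - h))^2] dominates an expression linear in
   [X, U, V] and the indicator of [X < a]; its mean is at least
   [h^2 / p - h^2]. *)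
Lemma mean_shortfall_le (a p : R) : 0 <= sigma -> 0 < p -> p < 1 ->
  (P [set w | (X w < a)%R] <= p%:E)%E ->
  \int[P]_w Num.max 0 (a - X w) <= sigma * Num.sqrt (p / (1 - p)).
Proof.
move=> sigma0 p0 p1 Pp.
pose U y := Num.max 0 (a + (-1) * y).
pose V y := Num.max 0 (- a + 1 * y).
have qU : quadratic U by exact: quadratic_pos.
have qV : quadratic V by exact: quadratic_pos.
have qA := quadratic_lt a.
set A : R -> R := \1_[set y | y < a] in qA.
pose h := mean U; pose g := mean V; pose q := mean A.
have -> : \int[P]_w Num.max 0 (a - X w) = h.
  by apply: eq_Rintegral => w _; rewrite /U mulN1r.
have hg : h + mu = a + g.
  rewrite -mean_id -(mean_cst a) -!meanD//; congr mean; apply/funext => y.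
  by rewrite /U /V; case: leP => ?; case: leP => ? /=; lra.
have h0 : 0 <= h.
  by rewrite -[0]mean_cst; apply: le_mean => // y; rewrite /U le_max lexx.
have g0 : 0 <= g.
  by rewrite -[0]mean_cst; apply: le_mean => // y; rewrite /V le_max lexx.
have qp : q <= p.
  have mA : measurable [set w | X w < a].
    rewrite (_ : [set w | _] = X @^-1` `]-oo, a[).
      exact: measurable_funPTI.
    by apply/seteqP; split => y /=; rewrite in_itv.
  have : (q%:E <= p%:E)%E.
    rewrite /q /mean /Rintegral.
    rewrite (_ : (fun w => _) = EFin \o \1_[set w | X w < a])//.
    rewrite integral_indic// setIT fineK//.
    exact: fin_num_measure.
  by rewrite lee_fin.
(* The squares are bounded below by tangents: [V ^+ 2 >= 2 * g * V - g ^+ 2] and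
   [U ^+ 2 >= 2 * t * U - t ^+ 2 * A]. The slope [h / p] maximizes [2 * t * h - t ^+ 2 * p]. *)
pose t := h / p.
pose k0 := - g ^+ 2 + (h - g) ^+ 2 - 2 * a * (h - g).
pose k1 := 2 * (h - g).
have key : k0 + (k1 * mu + (2 * g * g + (2 * t * h + (- t ^+ 2) * q)))
    <= sigma ^+ 2.
  have q3 : quadratic (fun y => 2 * t * U y + (- t ^+ 2) * A y).
    by apply: quadraticD; exact: quadraticZ.
  have q2 : quadratic (fun y => 2 * g * V y + (2 * t * U y + (- t ^+ 2) * A y)).
    by apply: quadraticD => //; exact: quadraticZ.
  have q1 : quadratic (fun y => k1 * id y +
      (2 * g * V y + (2 * t * U y + (- t ^+ 2) * A y))).
    by apply: quadraticD => //; exact: quadraticZ.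
  rewrite -mean_sq [leLHS](_ : _ = mean (fun y => k0 + (k1 * id y +
      (2 * g * V y + (2 * t * U y + (- t ^+ 2) * A y))))); last first.
    rewrite (meanD (quadratic_cst k0) q1).
    rewrite (meanD (quadraticZ k1 quadratic_id) q2).
    rewrite (meanD (quadraticZ _ qV) q3).
    rewrite (meanD (quadraticZ _ qU) (quadraticZ _ qA)).
    by rewrite mean_cst !meanZ// mean_id.
  apply: le_mean => //; first exact: quadraticD.
  move=> y; rewrite /A indicE.
  have -> : mu = a + g - h by lra.
  rewrite /k0 /k1.
  have [ya|ay] := ltP y a.
    have -> : U y = a - y by rewrite /U max_r; lra.
    have -> : V y = 0 by rewrite /V max_l//; lra.
    rewrite mem_set//=.
    have := sqr_ge0 (a - y - t); have := sqr_ge0 g; nra.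
  have -> : U y = 0 by rewrite /U max_l//; lra.
  have -> : V y = y - a by rewrite /V max_r; lra.
  rewrite memNset/=; last by apply/negP; rewrite -leNgt.
  have := sqr_ge0 (y - a - g); nra.
have ht : h = t * p by rewrite /t divfK// gt_eqF.
have t0 : 0 <= t by rewrite divr_ge0// ltW.
have H : h ^+ 2 * (1 - p) <= sigma ^+ 2 * p.
  have tq : t ^+ 2 * q <= t ^+ 2 * p by rewrite ler_wpM2l ?sqr_ge0.
  (* Substituting [mu = a + g - h] turns the left side of [key] into [2 * g * h - h ^+ 2 + 2 * t * h
     - t ^+ 2 * q]. *)
  have {}key : 2 * t * h - t ^+ 2 * p - h ^+ 2 <= sigma ^+ 2.
    have : 0 <= g * h by exact: mulr_ge0.
    have : mu = a + g - h by lra.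
    by move=> Emu gh; move: key; rewrite /k0 /k1 Emu; nra.
  have : p * (2 * t * h - t ^+ 2 * p - h ^+ 2) <= p * sigma ^+ 2.
    by rewrite ler_pM2l.
  by rewrite {1}ht; move: key; rewrite ht => ? ?; nra.
have h2 : h ^+ 2 <= sigma ^+ 2 * (p / (1 - p)).
  by rewrite mulrA ler_pdivlMr// subr_gt0.
rewrite -(ler_pXn2r (ltn0Sn 1)) ?nnegrE//; last first.
  by rewrite mulr_ge0// sqrtr_ge0.
by rewrite exprMn sqr_sqrtr// divr_ge0// ?subr_ge0 ltW.
Qed.

(** The clamped variable is centred at the clamped mean [c], not at [mu]: clamping being
    1-Lipschitz, the second moment about [c] is at most [sigma ^+ 2]. The quadratic bound on [expR]
    applies since [f y - c <= b - mu], and [c] cancels at the end. *)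
Lemma truncated_mgf_le (a b lambda : R) : 0 <= lambda -> mu <= b ->
  lambda * (b - mu) <= 3 / 4 ->
  (\int[P]_w (expR (lambda * (Num.min (Num.max (X w) a) b - mu)))%:E <=
   (expR (lambda * \int[P]_w Num.max 0 (a - X w) +
          lambda ^+ 2 * sigma ^+ 2)%R)%:E)%E.
Proof.
move=> lambda0 mub lb.
pose f y := Num.min (Num.max y a) b; pose c := f mu.
pose U y := Num.max 0 (a + (-1) * y).
have qU : quadratic U by exact: quadratic_pos.
have -> : \int[P]_w Num.max 0 (a - X w) = mean U.
  by apply: eq_Rintegral => w _; rewrite /U mulN1r.
have muc : mu <= c by rewrite /c /f le_min mub andbT le_max lexx.
have fc y : f y - c <= b - mu.
  by rewrite lerB// /f ge_min lexx orbT.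
have fc1 y : `|f y - c| <= `|y - mu| by exact: clamp_lipschitz.
have fU y : f y <= y + U y.
  rewrite /f /U ge_min; apply/orP; left.
  by case: (leP y a) => ?; case: (leP 0 (a + (-1) * y)) => ?; lra.
pose K := expR (lambda * (c - mu)).
have K0 : 0 <= K by exact: expR_ge0.
pose G y := K * (1 + (lambda * (id y + (U y + (- c)))
  + lambda ^+ 2 * (y - mu) ^+ 2)).
have q4 : quadratic (fun y => U y + (- c)) by exact: quadraticD.
have q3 : quadratic (fun y => id y + (U y + (- c))) by exact: quadraticD.
have q2 : quadratic (fun y => lambda * (id y + (U y + (- c)))
    + lambda ^+ 2 * (y - mu) ^+ 2).
  by apply: quadraticD; exact: quadraticZ.
have q1 : quadratic (fun y => 1 + (lambda * (id y + (U y + (- c)))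
    + lambda ^+ 2 * (y - mu) ^+ 2)) by exact: quadraticD.
have qG : quadratic G by exact: quadraticZ.
have expG y : expR (lambda * (f y - mu)) <= G y.
  rewrite (_ : f y - mu = (c - mu) + (f y - c)); last by ring.
  rewrite mulrDr expRD ler_wpM2l//.
  rewrite (le_trans (expR_le_quadratic _))//.
    by rewrite (le_trans _ lb)// ler_wpM2l.
  rewrite -addrA lerD2l lerD//.
    by rewrite ler_wpM2l// addrA lerB.
  rewrite exprMn ler_wpM2l ?sqr_ge0// -[leLHS]real_normK ?num_real//.
  by rewrite -[leRHS]real_normK ?num_real// lerXn2r ?nnegrE.
apply: (@le_trans _ _ (\int[P]_w (G (X w))%:E)%E).
  apply: ge0_le_integral => //.
  - apply/measurable_EFinP; apply: measurableT_comp => //.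
    apply: measurable_funM => //; apply: measurable_funB => //.
    by apply: measurable_minr => //; exact: measurable_maxr.
  - by apply/measurable_EFinP; apply: measurableT_comp => //; exact: qG.1.
  - by move=> w _; rewrite lee_fin expG.
have GE : (\int[P]_w (G (X w))%:E = (mean G)%:E)%E.
  by rewrite fineK// integrable_fin_num//; exact: quadratic_integrable.
rewrite GE lee_fin /G meanZ// (meanD (quadratic_cst 1) q2) mean_cst.
rewrite (meanD (quadraticZ lambda q3) (quadraticZ _ quadratic_sq)).
rewrite !meanZ// (meanD quadratic_id q4) (meanD qU (quadratic_cst _)).
rewrite mean_id mean_cst mean_sq.
rewrite (_ : lambda * mean U =
    lambda * (c - mu) + lambda * (mu + (mean U - c)));
  last by rewrite -mulrDr; congr (_ * _); lra.
by rewrite -addrA [leRHS]expRD ler_wpM2l// expR_ge1Dx.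
Qed.
End moments.

(** * Tail probabilities and quantiles *)

Section tails.
Context (d : measure_display) (T : measurableType d) (R : realType)
  (P : probability T R) (X : {RV P >-> R}).

Lemma measurable_rv_gt (a : R) : measurable [set w | a < X w].
Proof.
rewrite (_ : [set w | _] = X @^-1` [set` `]a, +oo[]).
  exact: measurable_funPTI.
by apply/seteqP; split => w /=; rewrite in_itv/= andbT.
Qed.

Lemma chebyshev_upper (mu sigma t : R) : ('E_P[X] = mu%:E)%E ->
  ('V_P[X] = (sigma ^+ 2)%R%:E)%E -> 0 < t ->
  (P [set w | (mu + t < X w)%R] <= (sigma ^+ 2 / t ^+ 2)%:E)%E.
Proof.
move=> EX VX t0.
apply: (@le_trans _ _ (P [set w | t <= `|X w - fine 'E_P[X]|])).
  apply: le_measure.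
  - by rewrite inE; exact: measurable_rv_gt.
  - rewrite inE; apply: measurable_le_set; apply: measurableT_comp => //.
    exact: measurable_funB.
  - by move=> w /= tw; rewrite EX/= (le_trans _ (ler_norm _))//; lra.
by rewrite (le_trans (chebyshev X t0))// VX -EFinM lee_fin mulrC.
Qed.

(** Stands in for Chebyshev's inequality when [sigma = 0], where the allowed deviation vanishes
    too. *)
Lemma variance0_upper (mu : R) : ('E_P[X] = mu%:E)%E -> ('V_P[X] = 0)%E ->
  (P [set w | (mu < X w)%R] = 0)%E.
Proof.
move=> EX; rewrite /variance unlock EX unlock => VX.
have m2 : measurable_fun setT (fun w => ((X w - mu) ^+ 2)%:E).
  by apply/measurable_EFinP; apply: measurable_funX; exact: measurable_funB.
have [] := ae_eq_integral_abs P measurableT m2.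
rewrite (eq_integral (fun w => ((X w - mu) ^+ 2)%:E)); last first.
  by move=> w _; rewrite gee0_abs// lee_fin sqr_ge0.
rewrite VX => /(_ erefl) H _.
apply: measure_negligible; first exact: measurable_rv_gt.
apply: negligibleS H => w /= muX /(_ Logic.I) /eqP.
by rewrite eqe sqrf_eq0 subr_eq0 gt_eqF.
Qed.

(** The infimum of the points where the distribution function reaches [p]: right continuity gives
    the first bound, continuity from below along [inf S - 1 / (n + 1)] the second. The law may have
    an atom at [a], hence two inequalities. *)
Lemma exists_quantile (p : R) : 0 < p -> p < 1 -> exists a,
  (p%:E <= P [set w | (X w <= a)%R])%E /\ (P [set w | (X w < a)%R] <= p%:E)%E.
Proof.
move=> p0 p1; pose S := [set r | (p%:E <= cdf X r)%E].
have cdfE r : cdf X r = P [set w | X w <= r] by [].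
have [r Sr] : S !=set0.
  apply: contrapT => S0.
  suff : (1 <= p%:E)%E by rewrite lee_fin leNgt p1.
  apply: cvge_le (@cvg_cdfy1 _ _ _ P X); apply: nearW => r.
  by rewrite leNgt; apply/negP => /ltW pr; apply: S0; exists r.
have Slb : has_lbound S.
  apply: contrapT => nlb.
  suff : (p%:E <= 0)%E by rewrite lee_fin leNgt p0.
  apply: cvge_ge (@cvg_cdfNy0 _ _ _ P X); apply: nearW => s.
  apply: contrapT => /negP; rewrite -ltNge => sp; apply: nlb; exists s => u Su.
  rewrite leNgt; apply/negP => us; move: sp; apply/negP; rewrite -leNgt.
  by rewrite (le_trans Su)// cdf_nondecreasing// ltW.
have infS : has_inf S by split => //; exists r.
have gtS s : inf S < s -> (p%:E <= cdf X s)%E.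
  move=> /(inf_lt infS.1)[u Su us].
  by rewrite (le_trans Su)// cdf_nondecreasing// ltW.
exists (inf S); split.
  rewrite -cdfE; apply: cvge_ge (@cdf_right_continuous _ _ _ P X (inf S)).
  by near=> s; apply: gtS; near: s; exact: nbhs_right_gt.
have -> : [set w | X w < inf S] =
    \bigcup_n [set w | X w <= inf S - n.+1%:R^-1].
  apply/seteqP; split => w /=.
    rewrite -subr_gt0 => /ltr_add_invr[n]; rewrite add0r => H.
    by exists n => //=; rewrite lerBrDr -lerBrDl ltW.
  move=> [n _ /=]/le_lt_trans; apply; rewrite ltrBlDr ltrDl invr_gt0 ltr0n.
  by [].
have mle (s : R) : measurable [set w | X w <= s].
  rewrite (_ : [set w | _] = ~` [set w | s < X w]).
    exact/measurableC/measurable_rv_gt.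
  by apply/seteqP; split => w /=; rewrite leNgt => /negP.
apply: cvge_le (@nondecreasing_cvg_mu _ _ _ P
  (fun n => [set w | X w <= inf S - n.+1%:R^-1]) _ _ _).
- apply: nearW => n /=; rewrite -cdfE leNgt; apply/negP => /ltW pS.
  have := inf_lbound Slb pS; rewrite leNgt => /negP; apply.
  by rewrite ltrBlDr ltrDl invr_gt0 ltr0n.
- by [].
- by apply: bigcup_measurable => n _.
- move=> m n mn; apply/subsetPset => w /= /le_trans; apply.
  by rewrite lerB// lef_pV2 ?posrE ?ltr0n// ler_nat.
Unshelve. all: by end_near. Qed.
End tails.

(** * Order statistics *)

Section order_statistics.
Context (R : realType) (n : nat).
Implicit Types (y : 'I_n -> R) (c : R).

Let count_sample (a : pred R) y :
  count a (sort <=%R [seq y i | i <- enum 'I_n]) = #|[pred i | a (y i)]|.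
Proof. by rewrite count_sort count_map cardE enumT size_filter -enumT. Qed.

(** Turns a comparison with an order statistic into a count, hence into a sum of indicators to which
    Chernoff bounds apply. *)
Lemma order_stat_le y k c : (0 < k <= n)%N ->
  (order_stat y k <= c) = (k <= #|[pred i | (y i <= c)%R]|)%N.
Proof.
move=> /andP[k0 kn]; rewrite /order_stat -(count_sample (<= c)).
set s := sort _ _; have ss : sorted <=%R s by exact: sort_le_sorted.
have size_s : size s = n by rewrite size_sort size_map -cardE card_ord.
apply/idP/idP => [|kc]; last by rewrite nth_count_le// prednK.
apply: contraTT; rewrite -ltnNge -ltNge => kc.
by rewrite nth_count_gt// size_s prednK// kn -ltnS prednK// kc.
Qed.

Lemma order_stat_ge y k c : (0 < k <= n)%N ->
  (c <= order_stat y k) = (#|[pred i | (y i < c)%R]| < k)%N.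
Proof.
move=> /andP[k0 kn]; rewrite /order_stat -(count_sample (< c)).
set s := sort _ _; have ss : sorted <=%R s by exact: sort_le_sorted.
have size_s : size s = n by rewrite size_sort size_map -cardE card_ord.
apply/idP/idP => [|kc]; last first.
  by rewrite nth_count_ge// size_s prednK// kn -ltnS prednK// kc.
apply: contraTT; rewrite -leqNgt -ltNge => kc.
by rewrite nth_count_lt// prednK.
Qed.

Lemma sum_indic_card (a : pred R) y :
  \sum_(i < n) \1_[set v | a v] (y i) = #|[pred i | a (y i)]|%:R :> R.
Proof.
rewrite -sum1_card natr_sum [RHS]big_mkcond/=; apply: eq_bigr => i _.
rewrite indicE inE; case: ifPn => ai; first by rewrite mem_set.
by rewrite memNset//; exact/negP.
Qed.

Lemma card_lt_ge y c :
  (#|[pred i | (y i < c)%R]| + #|[pred i | (c <= y i)%R]|)%N = n.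
Proof.
rewrite -[RHS]card_ord -(cardC [pred i | y i < c]); congr addn.
by apply: eq_card => i; rewrite !inE leNgt.
Qed.

End order_statistics.

(** * Measurability of the trimmed mean, and symmetry of the truncation *)

Section measurable_trimmed_mean.
Context (d : measure_display) (T : measurableType d) (R : realType) (n : nat).

(** By [order_stat_le], the event that the order statistic is at most [c] says that a sum of
    indicators is at least [k]. *)
Lemma measurable_order_stat (Y : 'I_n -> T -> R) (k : nat) : (0 < k <= n)%N ->
  (forall i, measurable_fun setT (Y i)) ->
  measurable_fun setT (fun w => order_stat (Y ^~ w) k).
Proof.
move=> kn mY; apply: (measurability (@RGenOInfty.G R)) => [|_ [_ [c ->] <-]].
  exact: RGenOInfty.measurableE.
rewrite setTI.
have mS : measurable [set w | k%:R <=
    \sum_(i < n) (\1_[set v | v <= c] (Y i w) : R)].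
  apply: measurable_le_set; apply: measurable_sum => i.
  apply: measurableT_comp => //; apply: measurable_indic.
  by rewrite (_ : [set v | v <= c] = [set` `]-oo, c]]).
rewrite (_ : _ @^-1` _ = ~` [set w | k%:R <=
    \sum_(i < n) (\1_[set v | v <= c] (Y i w) : R)]); first exact: measurableC.
apply/seteqP; split => w /=; rewrite in_itv/= andbT;
  rewrite (sum_indic_card (<= c) (Y ^~ w)) ler_nat -order_stat_le// ltNge.
  by move=> /negP.
by move=> /negP.
Qed.

Lemma measurable_truncation (a b x : T -> R) :
  measurable_fun setT a -> measurable_fun setT b -> measurable_fun setT x ->
  measurable_fun setT (fun w => truncation (a w) (b w) (x w)).
Proof.
move=> ma mb mx; apply: measurable_fun_ifT => //.
  exact: measurable_fun_ltr.
by apply: measurable_fun_ifT => //; exact: measurable_fun_ler.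
Qed.
End measurable_trimmed_mean.

Lemma truncation_minmax (R : realType) (a b x : R) : a <= b ->
  truncation a b x = Num.min (Num.max x a) b.
Proof.
by move=> ab; rewrite /truncation; case: (ltP b x) => ?; case: (leP a x) => ?;
  case: (leP x b) => ?; case: (leP a b) => ?; lra.
Qed.

Lemma truncationN (R : realType) (a b x : R) : a <= b ->
  truncation (- b) (- a) (- x) = - truncation a b x.
Proof.
move=> ab; rewrite /truncation !ltrN2 !lerN2.
by case: (ltP b x) => ?; case: (ltP x a) => ?; case: (leP x b) => ?;
  case: (leP a x) => ?; lra.
Qed.

(** * The one-sided bound *)

Section ln2.
Context (R : realType).

(** From [ln (1 + x) <= x] at [x = - 21 / 256]. The constant is chosen so that
    [15 / 32 - 21 / 32 = - 3 / 16], the rate in [fail]. *)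
Lemma ln2_ge : 21 / 32 <= ln 2 :> R.
Proof.
have h : (1 + - (21 / 256)) ^+ 8 * 2 >= 1 :> R by lra.
have : 0 <= ln ((1 + - (21 / 256)) ^+ 8 * 2) :> R by rewrite ln_ge0.
rewrite lnM ?posrE ?exprn_gt0//; last by lra.
rewrite lnXn; last by lra.
have : ln (1 + - (21 / 256)) <= - (21 / 256) :> R by rewrite le_ln1Dx//; lra.
by move: (ln _) (ln 2) => u v; lra.
Qed.

(** The constant is chosen so that [13 / 16 - 1 = - 3 / 16]. *)
Lemma ln2_le : ln 2 <= 13 / 16 :> R.
Proof.
have h : 2 <= (1 + 13 / 64) ^+ 4 :> R by lra.
have : ln 2 <= ln ((1 + 13 / 64) ^+ 4) :> R.
  by rewrite ler_ln ?posrE// exprn_gt0//; lra.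
rewrite lnXn; last by lra.
have : ln (1 + 13 / 64) <= 13 / 64 :> R by rewrite le_ln1Dx//; lra.
by move: (ln (1 + _)) (ln 2) => u v; lra.
Qed.
End ln2.

Lemma iidN (d : measure_display) (T : measurableType d) (R : realType)
  (P : probability T R) (I : finType) (Z : I -> {RV P >-> R}) :
  iid Z -> iid (fun i => - Z i : {RV P >-> R}).
Proof.
move=> [Zindep Zident]; split.
  move=> J B mB.
  have mB' i : measurable ((-%R : R -> R) @^-1` B i).
    by rewrite -[X in measurable X]setTI; exact: oppr_measurable.
  exact: (Zindep J (fun i => -%R @^-1` B i)).
move=> i j B mB; apply: (Zident i j (-%R @^-1` B)).
by rewrite -[X in measurable X]setTI; exact: oppr_measurable.
Qed.

Section upper_deviation.
Context (d : measure_display) (T : measurableType d) (R : realType)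
  (P : probability T R) (n k : nat) (Z : 'I_n + 'I_n -> {RV P >-> R})
  (mu sigma : R).
Hypothesis Z_iid : iid Z.
Hypothesis Z_mean : forall i, ('E_P[Z i] = mu%:E)%E.
Hypothesis Z_variance : forall i, ('V_P[Z i] = (sigma ^+ 2)%R%:E)%E.
Hypothesis sigma_ge0 : 0 <= sigma.
Hypothesis k_bounds : (0 < k < n)%N.

Let left : pred ('I_n + 'I_n) := fun i => if i is inl _ then true else false.
Let right : pred ('I_n + 'I_n) := fun i => if i is inr _ then true else false.

Let sum_left (F : 'I_n + 'I_n -> R) : \sum_(i | left i) F i = \sum_i F (inl i).
Proof. by rewrite big_sumType/= [X in _ + X]big_pred0// addr0. Qed.

Let sum_right (F : 'I_n + 'I_n -> R) :
  \sum_(i | right i) F i = \sum_i F (inr i).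
Proof. by rewrite big_sumType/= [X in X + _]big_pred0// add0r. Qed.

Let card_left : #|left|%:R = n%:R :> R.
Proof.
by rewrite -sum1_card natr_sum sum_left sumr_const card_ord.
Qed.

Let card_right : #|right|%:R = n%:R :> R.
Proof.
by rewrite -sum1_card natr_sum sum_right sumr_const card_ord.
Qed.

Let eps : R := k%:R / n%:R.
(** For [k = 16 / 3 * ln (8 / delta)], [fail] is [delta / 8] and [dev] is the claimed error. *)
Let fail : R := expR (- (3 / 16 * k%:R)).
Let dev : R := 9 * sigma * Num.sqrt (3 / 16 * eps).

Let n0 : 0 < n%:R :> R.
Proof. by case/andP: k_bounds => k0 kn; rewrite ltr0n (ltn_trans k0). Qed.

Let k0 : 0 < k%:R :> R.
Proof. by case/andP: k_bounds => k0 kn; rewrite ltr0n. Qed.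

Let eps0 : 0 < eps. Proof. by rewrite divr_gt0. Qed.

Let neps : n%:R * eps = k%:R.
Proof. by rewrite /eps mulrC divfK// gt_eqF. Qed.

Let above_event (b : R) := [set w | k%:R <=
  \sum_(i | right i) (\1_[set v | b < v] (Z i w) : R)].

Let measurable_above b : measurable (above_event b).
Proof.
apply: measurable_le_set; apply: measurable_sum_comp.
apply: measurable_indic; rewrite (_ : [set v | b < v] = [set` `]b, +oo[])//.
by apply/seteqP; split => v /=; rewrite in_itv/= andbT.
Qed.

(** The expected count is at most [15 / 32 * k], so the Chernoff exponent is at most
    [k * (15 / 32 - ln 2)]. *)
Let above_event_le (b : R) :
  (forall i, P [set w | (b < Z i w)%R] <= (15 / 32 * eps)%:E)%E ->
  (P (above_event b) <= fail%:E)%E.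
Proof.
move=> Pb; have mB : measurable [set v | b < v].
  rewrite (_ : [set v | b < v] = [set` `]b, +oo[])//.
  by apply/seteqP; split => v /=; rewrite in_itv/= andbT.
have /le_trans := @count_upper_tail _ _ _ _ _ _ Z_iid.1 right _
  (15 / 32 * eps) k%:R mB (fun i _ => Pb i).
apply.
rewrite lee_fin ler_expR card_right mulrCA neps.
have : k%:R * (21 / 32) <= k%:R * ln 2 :> R by rewrite ler_pM2l// ln2_ge.
lra.
Qed.

Let above_eventC (b : R) w : ~ above_event b w ->
  (#|[pred j | (b < Z (inr j) w)%R]| < k)%N.
Proof.
rewrite /above_event/= sum_right => /negP; rewrite -ltNge.
by rewrite (sum_indic_card (> b) (fun j => Z (inr j) w)) ltr_nat.
Qed.

(* The strict inequalities between cardinals are those satisfied both by the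
   order statistics of ranks [k] and [n - k] of the second half of the sample
   and by their opposites, taken in reverse order, for the opposite sample. *)
Lemma upper_deviation : exists2 B : set T,
  measurable B /\ (P B <= (3 * fail)%:E)%E &
  forall w, ~ B w -> forall al be : R, al <= be ->
    (forall c, (k < #|[pred j | (Z (inr j) w <= c)%R]|)%N -> al <= c) ->
    (forall c, (#|[pred j | (c < Z (inr j) w)%R]| < k)%N -> be <= c) ->
    n%:R^-1 * \sum_j truncation al be (Z (inl j) w) <= mu + dev.
Proof.
have fail0 : 0 <= fail by exact: expR_ge0.
have mean_le (F : 'I_n -> R) (c : R) : \sum_j F j <= n%:R * c ->
    n%:R^-1 * \sum_j F j <= c.
  by move=> Fc; rewrite mulrC ler_pdivrMr// mulrC.
have dev0 : 0 <= dev by rewrite !mulr_ge0 ?sqrtr_ge0.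
have [Ptail|/existsNP[i0 Ptail]] := pselect (forall i,
    (P [set w | (mu + dev < Z i w)%R] <= (15 / 32 * eps)%:E)%E).
  exists (above_event (mu + dev)).
    split => //; rewrite (le_trans (above_event_le Ptail))// lee_fin; lra.
  move=> w /above_eventC Bw al be albe _ /(_ _ Bw) be_le.
  apply: mean_le; rewrite -[X in X%:R * _](card_ord n) mulr_natl -sumr_const.
  apply: ler_sum => j _; rewrite (le_trans _ be_le)//.
  by rewrite truncation_minmax// ge_min lexx orbT.
have sigma_gt0 : 0 < sigma.
  rewrite lt_neqAle sigma_ge0 andbT; apply/eqP => sigma0; apply: Ptail.
  rewrite (_ : dev = 0) ?addr0; last by rewrite /dev -sigma0 mulr0 mul0r.
  rewrite (variance0_upper (Z_mean i0)); last first.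
    by rewrite Z_variance -sigma0 expr0n.
  by rewrite lee_fin mulr_ge0// ltW.
have dev_sq : dev ^+ 2 = 243 / 16 * eps * sigma ^+ 2.
  rewrite /dev !exprMn sqr_sqrtr; first by field.
  by rewrite mulr_ge0// ltW.
have dev_gt0 : 0 < dev by rewrite !mulr_gt0// sqrtr_gt0 mulr_gt0.
(* Chebyshev's bound is [16 / (243 * eps)]; it is at most [15 / 32 * eps] once
   [eps ^+ 2 >= 512 / 3645], a number just below [9 / 64]. *)
have eps_small : eps < 3 / 8.
  rewrite ltNge; apply/negP => eps38; apply: Ptail.
  rewrite (le_trans (chebyshev_upper (Z_mean i0) (Z_variance i0) dev_gt0))//.
  rewrite lee_fin dev_sq ler_pdivrMr; last by rewrite -dev_sq exprn_gt0.
  rewrite mulrA -[leLHS]mul1r ler_wpM2r ?sqr_ge0//.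
  by move: eps38; move: (eps) => x x38; nra.
pose e := Num.sqrt eps.
have e_sq : e ^+ 2 = eps by rewrite sqr_sqrtr// ltW.
have e_gt0 : 0 < e by rewrite sqrtr_gt0.
(* Chebyshev's inequality gives a tail of at most [eps / 4], and [lambda * (b - mu)] will be exactly
   [3 / 4], the limit allowed in [truncated_mgf_le]. *)
pose b := mu + 2 * sigma / e.
have b_tail i : (P [set w | (b < Z i w)%R] <= (15 / 32 * eps)%:E)%E.
  have t0 : 0 < 2 * sigma / e by rewrite divr_gt0// mulr_gt0.
  rewrite (le_trans (chebyshev_upper (Z_mean i) (Z_variance i) t0))//.
  rewrite lee_fin !exprMn exprVn e_sq.
  rewrite [leLHS](_ : _ = eps / 4); first by have := eps0; lra.
  by field; rewrite !gt_eqF.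
(* The order [2 * eps] makes the lower-tail exponent [k * (ln 2 - 1)]. *)
pose p := 2 * eps.
have p_gt0 : 0 < p by have := eps0; rewrite /p; lra.
have p_lt1 : p < 1 by rewrite /p; lra.
have [a [pa ap]] := exists_quantile (Z i0) p_gt0 p_lt1.
have mle (c : R) : measurable [set v : R | v <= c].
  by rewrite (_ : [set v | v <= c] = [set` `]-oo, c]]).
have mlt (c : R) : measurable [set v : R | v < c].
  by rewrite (_ : [set v | v < c] = [set` `]-oo, c[]).
have {}pa i : (p%:E <= P (Z i @^-1` [set v : R | (v <= a)%R]))%E.
  have <- : P (Z i0 @^-1` [set v | v <= a]) = P (Z i @^-1` [set v | v <= a])
    := Z_iid.2 i0 i _ (mle a).
  exact: pa.
have {}ap i : (P [set w | (Z i w < a)%R] <= p%:E)%E.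
  have -> : P [set w | (Z i w < a)%R] = P [set w | (Z i0 w < a)%R]
    := Z_iid.2 i i0 _ (mlt a).
  exact: ap.
(* Off this event more than [k] points of the second half are at most [a], which forces
   [al <= a]. *)
pose A2 := [set w |
  (\sum_(i | right i) (\1_[set v | v <= a] (Z i w) : R) <= k%:R)].
have PA2 : (P A2 <= fail%:E)%E.
  rewrite (le_trans (count_lower_tail Z_iid.1 _ (mle a) (fun i _ => pa i)))//.
  rewrite lee_fin ler_expR card_right /p (_ : 2 * eps / 2 = eps); last by field.
  rewrite neps.
  have : k%:R * ln 2 <= k%:R * (13 / 16) :> R by rewrite ler_pM2l// ln2_le.
  lra.
pose lambda := 3 / 8 * e / sigma.
have lambda_gt0 : 0 < lambda by rewrite divr_gt0// mulr_gt0.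
pose phi y := Num.min (Num.max y a) b.
pose A3 := [set w | n%:R * (lambda * dev) <=
  \sum_(i | left i) lambda * (phi (Z i w) - mu)].
have mphi : measurable_fun [set: R] phi.
  by apply: measurable_minr => //; exact: measurable_maxr.
have mg : measurable_fun [set: R] (fun v => lambda * (phi v - mu)).
  by apply: measurable_funM => //; exact: measurable_funB.
(* Here [(387 / 100) ^+ 2 < 243 / 16]. *)
have dev_ge : 387 / 100 * sigma * e <= dev.
  rewrite -(ler_pXn2r (ltn0Sn 1)) ?nnegrE ?mulr_ge0 ?(ltW e_gt0)//.
  rewrite dev_sq !exprMn e_sq mulrAC ler_wpM2r ?sqr_ge0// ler_pM2r//.
  by lra.
(* As [eps < 3 / 8], [p / (1 - p)] is at most [8 * eps], and [8 < (283 / 100) ^+ 2]. *)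
have shortfall i : \int[P]_w Num.max 0 (a - Z i w) <= 283 / 100 * sigma * e.
  apply: (le_trans (mean_shortfall_le (Z_mean i) (Z_variance i) sigma_ge0 p_gt0
    p_lt1 (ap i))).
  rewrite -mulrA mulrCA ler_pM2l//.
  rewrite -(ler_pXn2r (ltn0Sn 1)) ?nnegrE ?mulr_ge0 ?sqrtr_ge0 ?(ltW e_gt0)//.
  have p1 : 0 < 1 - p by rewrite subr_gt0.
  have p_odds : 0 <= p / (1 - p) by rewrite divr_ge0// ltW.
  rewrite sqr_sqrtr// exprMn e_sq ler_pdivrMr// /p.
  by have := eps0; move: eps_small; move: (eps) => x x38 x0; nra.
have PA3 : (P A3 <= fail%:E)%E.
  have mgf i : left i -> (\int[P]_w (expR (lambda * (phi (Z i w) - mu)))%:E <=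
      (expR (lambda * (283 / 100 * sigma * e)
             + lambda ^+ 2 * sigma ^+ 2))%:E)%E.
    move=> _.
    apply: (le_trans (truncated_mgf_le (Z_mean i) (Z_variance i) a _ _ _)).
    - exact: ltW.
    - by rewrite /b lerDl divr_ge0 ?ltW// mulr_gt0.
    - by rewrite /b /lambda addrAC subrr add0r le_eqVlt; apply/orP; left;
        apply/eqP; field; rewrite !gt_eqF.
    - by rewrite lee_fin ler_expR lerD2r ler_pM2l.
  rewrite (le_trans (chernoff_independent_sum Z_iid.1 _ mg mgf))//.
  rewrite lee_fin ler_expR card_left -mulrBr.
  (* Per observation the exponent is at most [(9 / 64 - 39 / 100) * eps], which is below
     [- (3 / 16) * eps]; here [39 / 100 = 3 / 8 * (387 / 100 - 283 / 100)]. *)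
  have E : lambda ^+ 2 * sigma ^+ 2 = 9 / 64 * eps.
    by rewrite -e_sq /lambda; field; rewrite gt_eqF.
  have H : lambda * (283 / 100 * sigma * e) - lambda * dev <=
      - (39 / 100) * eps.
    apply: (@le_trans _ _ (lambda * ((283 / 100 - 387 / 100) * sigma * e))).
      by rewrite -mulrBr ler_pM2l//; lra.
    rewrite -e_sq /lambda le_eqVlt; apply/orP; left; apply/eqP.
    by field; rewrite gt_eqF.
  rewrite (_ : - (3 / 16 * k%:R) = n%:R * (- (3 / 16) * eps)); last first.
    by rewrite -neps; ring.
  rewrite ler_pM2l// E.
  have := eps0; move: H.
  by move: (lambda * (_ * _)) (lambda * dev) (eps) => u v x; lra.
have measurable_sum_le (g : R -> R) (J : pred ('I_n + 'I_n)) (c : R) :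
    measurable_fun [set: R] g ->
    measurable [set w | c <= \sum_(i | J i) g (Z i w)].
  by move=> mf; apply: measurable_le_set; exact: measurable_sum_comp.
have mA3 : measurable A3 by exact: (measurable_sum_le _ _ _ mg).
have mA2 : measurable A2.
  rewrite (_ : A2 = [set w | - k%:R <=
      \sum_(i | right i) - (\1_[set v | v <= a] (Z i w) : R)]).
    apply: (measurable_sum_le (fun v : R => - (\1_[set u | u <= a] v : R))).
    by apply: measurable_funN; exact: measurable_indic.
  by apply/seteqP; split => w /=; rewrite sumrN lerN2.
exists (above_event b `|` A2 `|` A3).
  split; first by apply: measurableU => //; exact: measurableU.
  apply: (@le_trans _ _ (P (above_event b) + P A2 + P A3)%E).
    rewrite (le_trans (measureU2 _ _ _))//; first exact: measurableU.
    by rewrite leeD2r// measureU2.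
  rewrite (_ : 3 * fail = fail + fail + fail); last by lra.
  by rewrite !EFinD leeD// leeD// above_event_le.
move=> w /not_orP[/not_orP[Aw A2w] A3w] al be albe al_le be_le.
have be_b : be <= b by apply: be_le; exact: above_eventC.
have al_a : al <= a.
  apply: al_le; move/negP : A2w; rewrite -ltNge sum_right.
  by rewrite (sum_indic_card (<= a) (fun j => Z (inr j) w)) ltr_nat.
move/negP : A3w; rewrite -ltNge sum_left -mulr_sumr mulrCA ltr_pM2l//.
rewrite big_split/= sumr_const card_ord => A3w.
apply: mean_le; rewrite mulrDr.
apply: (@le_trans _ _ (\sum_j phi (Z (inl j) w))); last first.
  by rewrite -lerBlDl (le_trans _ (ltW A3w))// mulNrn mulr_natl.
(* Truncation is monotone in both thresholds, and [phi] has [a >= al] and [b >= be] in their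
   place. *)
apply: ler_sum => j _; rewrite truncation_minmax//.
rewrite /phi le_min !ge_min be_b orbT andbT ge_max le_max lexx/=.
by rewrite le_max al_a orbT.
Qed.
End upper_deviation.

(** * The two-sided bound *)

Theorem theorem6 (d : measure_display) (T : measurableType d) (R : realType)
  (P : probability T R) (n : nat) (X Y : 'I_n -> {RV P >-> R})
  (mu sigma delta : R)
  (XY_iid : iid (pooled X Y))
  (XY_mean : forall i, ('E_P[pooled X Y i] = mu%:E)%E)
  (sigma_ge0 : 0 <= sigma)
  (XY_variance : forall i, ('V_P[pooled X Y i] = (sigma ^+ 2)%R%:E)%E)
  (delta_gt0 : 0 < delta) (delta_lt1 : delta < 1)
  (n_large : 16 / 3 * ln (8 / delta) < n%:R)
  (trim_integer : trim_level n delta * n%:R \is a Num.int)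
  (* the truncation is defined only between ordered thresholds *)
  (thresholds_ordered : {ae P, forall w,
     lower_threshold delta (Y ^~ w) <= upper_threshold delta (Y ^~ w)}) :
  ((1 - delta)%:E <=
   P [set w | (`|trimmed_mean delta (X ^~ w) (Y ^~ w) - mu| <=
              9 * sigma * Num.sqrt (ln (8 / delta) / n%:R))%R])%E.
Proof.
set L := ln (8 / delta) in n_large *.
have d8 : 0 < 8 / delta by rewrite divr_gt0.
have L0 : 0 < L by rewrite ln_gt0// ltr_pdivlMr// mul1r; lra.
have n0 : 0 < n%:R :> R by lra.
have levelE : trim_level n delta * n%:R = 16 / 3 * L.
  by rewrite /trim_level -/L; field; rewrite gt_eqF.
have [k kE] : exists k, 16 / 3 * L = k%:R.
  have : 16 / 3 * L \is a Num.nat.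
    by rewrite natrEint -levelE trim_integer levelE/=; lra.
  by move/natrP.
have k0 : (0 < k)%N by rewrite -(ltr0n R) -kE; lra.
have kn : (k < n)%N by rewrite -(ltr_nat R) -kE.
have lowerE w : lower_threshold delta (Y ^~ w) = order_stat (Y ^~ w) k.
  by rewrite /lower_threshold levelE kE natrK.
have upperE w : upper_threshold delta (Y ^~ w) = order_stat (Y ^~ w) (n - k).
  rewrite /upper_threshold mulrBl mul1r levelE kE -natrB ?natrK//.
  exact: ltnW.
have LnE : L / n%:R = 3 / 16 * (k%:R / n%:R).
  by rewrite -kE; field; rewrite gt_eqF.
have failE : expR (- (3 / 16 * k%:R)) = delta / 8 :> R.
  rewrite -kE (_ : 3 / 16 * (16 / 3 * L) = L); last by field.
  by rewrite expRN lnK ?posrE// invf_div.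
have kin : (0 < k <= n)%N by rewrite k0 ltnW.
have nkin : (0 < n - k <= n)%N by rewrite subn_gt0 kn leq_subr.
have knb : (0 < k < n)%N by rewrite k0.
have [B1 [mB1 PB1] B1up] := upper_deviation XY_iid XY_mean XY_variance
  sigma_ge0 knb.
have XYN_mean i : ('E_P[(- pooled X Y i : {RV P >-> R})%R] = (- mu)%:E)%E.
  exact: (mean_opp (XY_mean i) (XY_variance i)).
have XYN_var i :
    ('V_P[(- pooled X Y i : {RV P >-> R})%R] = (sigma ^+ 2)%R%:E)%E.
  exact: (variance_opp (XY_mean i) (XY_variance i)).
(* The upper deviation of the opposite sample is the lower deviation of the original one. *)
have [B2 [mB2 PB2] B2up] := upper_deviation (iidN XY_iid) XYN_mean XYN_var
  sigma_ge0 knb.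
rewrite failE -LnE in PB1 PB2 B1up B2up.
set dev := 9 * sigma * Num.sqrt (L / n%:R) in B1up B2up *.
have [N [mN PN0 Nord]] := thresholds_ordered.
set E := [set w | _].
have mY i : measurable_fun setT (Y i : T -> R) by [].
have mlow : measurable_fun setT (fun w => lower_threshold delta (Y ^~ w)).
  by under eq_fun do rewrite lowerE; exact: measurable_order_stat.
have mup : measurable_fun setT (fun w => upper_threshold delta (Y ^~ w)).
  by under eq_fun do rewrite upperE; exact: measurable_order_stat.
have mtm : measurable_fun setT (fun w => trimmed_mean delta (X ^~ w) (Y ^~ w)).
  apply: measurable_funM => //; apply: measurable_sum => i.
  exact: measurable_truncation.
have mE : measurable E.
  rewrite (_ : E = [set w | - dev <=
      - `|trimmed_mean delta (X ^~ w) (Y ^~ w) - mu|]).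
    apply: measurable_le_set; apply: measurable_funN.
    by apply: measurableT_comp => //; exact: measurable_funB.
  by apply/seteqP; split => w /=; rewrite lerN2.
have BE : ~` (B1 `|` B2 `|` N) `<=` E.
  move=> w /= /not_orP[/not_orP[B1w B2w] Nw].
  have ord : lower_threshold delta (Y ^~ w) <= upper_threshold delta (Y ^~ w).
    by apply: contrapT => no; apply: Nw; exact: Nord.
  rewrite /E/= ler_norml; apply/andP; split.
    have ordN : - upper_threshold delta (Y ^~ w) <=
        - lower_threshold delta (Y ^~ w).
      by rewrite lerN2.
    suff : n%:R^-1 * (\sum_j truncation (- upper_threshold delta (Y ^~ w))
        (- lower_threshold delta (Y ^~ w)) (- X j w)) <= - mu + dev.
      under eq_bigr do rewrite truncationN//.
      by rewrite sumrN mulrN /trimmed_mean => H; lra.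
    (* Rank [n - k] from the bottom is rank [k + 1] from the top: the lower threshold of the
       opposite sample lies below [c] exactly when more than [k] of its points do. *)
    apply: (B2up w B2w) => // c.
      rewrite lerNl upperE order_stat_ge// => kc.
      rewrite ltn_subRL -[ltnRHS](card_lt_ge (Y ^~ w) (- c)) addnC ltn_add2l.
      by rewrite (leq_trans kc)// subset_leq_card//; apply/fintype.subsetP => i;
        rewrite !inE lerNl.
    rewrite lerNl lowerE order_stat_ge//; apply: leq_ltn_trans.
    by apply/subset_leq_card/fintype.subsetP => i; rewrite !inE ltrNr.
  rewrite lerBlDl; apply: (B1up w B1w) => // c.
    by rewrite lowerE order_stat_le// => /ltnW.
  rewrite upperE order_stat_le// => kc; rewrite leq_subLR.
  rewrite -[leqLHS](card_ord n) -(cardC [pred i | c < Y i w]).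
  rewrite leq_add ?(ltnW kc)// subset_leq_card//; apply/fintype.subsetP => i.
  by rewrite !inE -leNgt.
have mU : measurable (B1 `|` B2 `|` N) by do 2!apply: measurableU => //.
apply: (@le_trans _ _ (P (~` (B1 `|` B2 `|` N)))); last first.
  by apply: le_measure BE; rewrite inE//; exact: measurableC.
rewrite probability_setC// EFinB leeB//.
apply: (@le_trans _ _ (P B1 + P B2 + P N)%E).
  rewrite (le_trans (measureU2 _ _ _))//; first exact: measurableU.
  by rewrite leeD2r// measureU2.
have -> : P N = 0%E := PN0.
(* The two exceptional events have total probability at most [6 * (delta / 8)]. *)
rewrite adde0 (le_trans (leeD PB1 PB2))// -EFinD lee_fin; lra.
Qed.
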